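(* Let $v^{(\ell)}_j$ ($\ell \ge 0$, $0 \le j \le 2^{\ell+1}-1$) be the rational numbers defined by $v^{(0)}_0 = 1$, $v^{(0)}_1 = 1$, and, for $\ell \ge 1$, $$v^{(\ell)}_0 = 1,\quad v^{(\ell)}_1 = 2,\quad v^{(\ell)}_{2j} = -\frac{v^{(\ell-1)}_j}{v^{(\ell)}_{2j-1}},\quad v^{(\ell)}_{2j+1} = 1 + (-1)^j - v^{(\ell)}_{2j}\qquad (1 \le j \le 2^\ell - 1).$$ For $\ell \ge 0$ let $g_\ell(z) = \frac{1}{z}\prod_{h=0}^{\ell}(1 - z^{-2^h}) \in \mathbb{Q}(z)$. Then, for every $\ell \ge 0$, $$g_\ell(z) = \cfrac{v^{(\ell)}_0}{z+1 + \cfrac{v^{(\ell)}_1}{z-1 + \cfrac{v^{(\ell)}_2}{z+1 + \cfrac{\ddots}{\ddots + \cfrac{v^{(\ell)}_{2^{\ell+1}-1}}{z-1}}}}},$$ where the $j$-th denominator (for $j = 0, 1, \ldots, 2^{\ell+1}-1$) is $z+1$ if $j$ is even and $z-1$ if $j$ is odd. Moreover, for every $\ell \ge 0$, all the partial quotients $a_i(z) \in \mathbb{Q}[z]$ in the continued fraction expansion $g_\ell(z) = [0; a_1(z), \ldots, a_m(z)] = \cfrac{1}{a_1(z) + \cfrac{1}{\ddots + \cfrac{1}{a_m(z)}}}$ are polynomials of degree one. *)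

(* Defs.v *)
From mathcomp Require Import all_boot all_order all_algebra.
Set Implicit Arguments.
Unset Strict Implicit.
Unset Printing Implicit Defensive.
Import GRing.Theory.
Local Open Scope ring_scope.

(* One level of the recursion: from [u] = (v^(l-1)_j)_j to (v^(l)_j)_j. *)
Fixpoint vnext (u : nat -> rat) (k : nat) : rat :=
  match k with
  | 0 => 1
  | 1 => 2
  | k'.+1 => if odd k then 1 + (-1) ^+ k./2 - vnext u k'
             else - (u k./2 / vnext u k')
  end.

(* [v l j] is v^(l)_j; it is meaningful only for j <= 2 ^ l.+1 - 1. *)
Fixpoint v (l : nat) : nat -> rat :=
  if l is l'.+1 then vnext (v l') else fun=> 1.

Lemma v00 : v 0 0 = 1. Proof. by []. Qed.
Lemma v01 : v 0 1 = 1. Proof. by []. Qed.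
Lemma vS0 l : v l.+1 0 = 1. Proof. by []. Qed.
Lemma vS1 l : v l.+1 1 = 2. Proof. by []. Qed.

Lemma vS_even l j : (0 < j)%N ->
  v l.+1 (2 * j)%N = - (v l j / v l.+1 (2 * j - 1)%N).
Proof.
case: j => // j _; rewrite mul2n doubleS subn1 /=.
by rewrite odd_double /= doubleK.
Qed.

Lemma vS_odd l j : (0 < j)%N ->
  v l.+1 (2 * j + 1)%N = 1 + (-1) ^+ j - v l.+1 (2 * j)%N.
Proof.
case: j => // j _; rewrite mul2n addn1 doubleS /=.
by rewrite odd_double /= uphalf_double.
Qed.

Notation Qz := {fraction {poly rat}}.

Definition Qz_const (c : rat) : Qz := tofrac c%:P.

Definition z : Qz := tofrac 'X.

Definition g (l : nat) : Qz := z^-1 * \prod_(h < l.+1) (1 - z ^- (2 ^ h)).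

(* The finite continued fraction b_0 / (c_0 + b_1 / (c_1 + ... + b_n / c_n))
   attached to the list of pairs (b_i, c_i). *)
Definition gencf (F : fieldType) (s : seq (F * F)) : F :=
  foldr (fun bc t => bc.1 / (bc.2 + t)) 0 s.

Definition den (j : nat) : Qz := if odd j then z - 1 else z + 1.

(* f = [a0; a_1, ..., a_m] with a = (a_1, ..., a_m). As usual for continued
   fractions over Q[z], the a_i with i >= 1 are required to be nonconstant;
   the expansion is then unique and no denominator vanishes in [gencf]. *)
Definition cf_expansion (f : Qz) (a0 : {poly rat}) (a : seq {poly rat}) : Prop :=
  (forall p, p \in a -> (1 < size p)%N) /\
  f = tofrac a0 + gencf [seq (1, tofrac p) | p : {poly rat} <- a].

(* Main.v *)
Require Import Defs.
From HB Require Import structures.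
From mathcomp Require Import all_boot all_order all_algebra.
From mathcomp Require Import zify ring.
Set Implicit Arguments.
Unset Strict Implicit.
Unset Printing Implicit Defensive.
Import GRing.Theory Num.Theory.
Local Open Scope ring_scope.

(** Nonvanishing: in the recursion, v^(l)_j is a 2-adic unit except that it has
    valuation 1 at j = 1 and valuation -1 at j = 2^l and j = 2^l + 1 (l >= 1);
    this pattern reproduces itself from one level to the next.

    Identity: g_(l+1)(z) = (z - 1) g_l(z^2).  If t_j denotes the tail of the
    level l+1 fraction starting at v^(l+1)_j, and s_k the tail of the level l
    fraction in z^2 starting at v^(l)_k, then backward induction gives
    s_k = - t_(2k-1) t_(2k) for k >= 1, and then t_0 = (z - 1) s_0.

    Degrees: dividing out the nonzero constants v^(l)_j turns this fraction into
    a regular one with linear partial quotients, and the regular expansion is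
    unique because every tail has negative degree. *)

Local Notation "x %:F" := (tofrac x).

(* The units of the localisation of Z at the primes dividing [d]. *)
Definition local_unit (d : int) : {pred rat} :=
  fun x => coprimez d (numq x) && coprimez d (denq x).

Lemma local_unit0 d : (0 \in local_unit d) = (`|d|%N == 1%N).
Proof. by rewrite unfold_in /coprimez gcdz0 gcdz1 andbT. Qed.

Lemma local_unit_frac d m n :
  coprimez d m -> coprimez d n -> m%:~R / n%:~R \in local_unit d.
Proof.
case: divqP => [_|k x _]; rewrite unfold_in.
  by rewrite /coprimez gcdz1 andbT => _ ->.
by rewrite !coprimezMr => /andP[_ ->] /andP[_ ->].
Qed.

Lemma local_unit_sdivr_closed d : sdivr_closed (local_unit d).
Proof.
split=> [|x y]; first by rewrite unfold_in coprimezN /coprimez gcdz1.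
rewrite !unfold_in => /andP[nx dx] /andP[ny dy].
rewrite -[x]divq_num_den -[y]divq_num_den invf_div mulf_div -!rmorphM /=.
by apply: local_unit_frac; rewrite coprimezMr ?nx ?dx.
Qed.

HB.instance Definition _ d :=
  GRing.isSdivClosed.Build rat (local_unit d) (local_unit_sdivr_closed d).

Lemma local_unitMD d k x :
  x \in local_unit d -> (k * d)%:~R + x \in local_unit d.
Proof.
rewrite unfold_in => /andP[nx dx]; have den0 := denq_neq0 x.
rewrite -[x]divq_num_den -[_%:~R](@mulfK _ (denq x)%:~R) ?intr_eq0 //.
rewrite -mulrDl -rmorphM -rmorphD /=; apply: local_unit_frac => //.
by rewrite /coprimez mulrAC gcdzMDl.
Qed.

Lemma v_double l k : v l.+1 k.+1.*2 = - (v l k.+1 / v l.+1 k.*2.+1).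
Proof. by rewrite -mul2n vS_even // mul2n doubleS subn1. Qed.

Lemma v_doubleS l k : v l.+1 k.+1.*2.+1 = 1 + (-1) ^+ k.+1 - v l.+1 k.+1.*2.
Proof. by rewrite -[k.+1.*2.+1]addn1 -mul2n vS_odd. Qed.

Lemma add1_signr (R : pzRingType) k : 1 + (-1) ^+ k = (~~ odd k * 2)%:R :> R.
Proof. by rewrite -signr_odd; case: (odd k); rewrite ?subrr. Qed.

(* For [1 < j < 2 ^ m.+2] the 2-adic valuation of v^(m+1)_j is -1 if
   [j./2 = 2 ^ m] and 0 otherwise; [scale2 m j./2] compensates for it. *)
Definition scale2 (m k : nat) : nat := (k == 2 ^ m)%N.+1.

Definition scaled_v (m j : nat) : rat := (scale2 m j./2)%:R * v m.+1 j.

Lemma scale2_mul_pred m k : (1 < k)%N ->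
  (scale2 m.+1 k.-1 * scale2 m.+1 k = scale2 m k./2)%N.
Proof. by rewrite /scale2 expnS => k1; do 3!case: eqP => //; lia. Qed.

Lemma scaled_v2 m : scaled_v m.+1 2 = -1.
Proof.
have -> : scaled_v m.+1 2 = (scale2 m.+1 1)%:R * -1 by [].
by rewrite /scale2 expnS; case: eqP => [|_]; [lia | rewrite mul1r].
Qed.

Lemma scaled_v_double m k :
  scaled_v m.+1 k.+2.*2 = - (scaled_v m k.+2 / scaled_v m.+1 k.+1.*2.+1).
Proof.
rewrite /scaled_v doubleK (half_bit_double k.+1 true).
rewrite -(@scale2_mul_pred m k.+2) // v_double mulrN mulrA natrM.
by rewrite -[in RHS](mulrA _%:R) -mulf_div divff ?mul1r ?pnatr_eq0.
Qed.

Lemma scaled_v_doubleS m k :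
  scaled_v m k.+1.*2.+1 =
    (scale2 m k.+1 * ~~ odd k.+1 * 2)%:R - scaled_v m k.+1.*2.
Proof.
rewrite /scaled_v doubleK (half_bit_double k.+1 true).
by rewrite v_doubleS mulrBr add1_signr -natrM mulnA.
Qed.

Lemma scaled_v_local_unit m j :
  (1 < j < 2 ^ m.+2)%N -> scaled_v m j \in local_unit 2.
Proof.
elim: m j => [|m IHm]; first by case=> [|[|[|[|j]]]].
rewrite [in (2 ^ m.+3)%N]expnS; elim=> [//|j IHj] j_bound.
have [k [jE|jE]] : exists k, j.+1 = k.+1.*2 \/ j.+1 = k.+1.*2.+1.
  by exists j.-1./2; lia.
- case: k jE => [->|k jE]; first by rewrite scaled_v2.
  have j_pred : j = k.+1.*2.+1 by lia.
  rewrite jE scaled_v_double rpredN rpred_div //; first by apply: IHm; lia.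
  by rewrite -j_pred; apply: IHj; lia.
- have j_pred : j = k.+1.*2 by lia.
  rewrite jE scaled_v_doubleS; apply: (@local_unitMD 2 (_ * _)%N).
  by rewrite rpredN -j_pred; apply: IHj; lia.
Qed.

Lemma v_neq0 l j : (j < 2 ^ l.+1)%N -> v l j != 0.
Proof.
case: l j => [//|m] [//|[//|j]] j_bound.
have : scaled_v m j.+2 != 0.
  have := @scaled_v_local_unit m j.+2 j_bound.
  by apply: contraTneq => ->; rewrite local_unit0.
by rewrite mulf_eq0 negb_or => /andP[].
Qed.

Definition alt_cf (F : fieldType) (x : F) (b : nat -> F) (j n : nat) : F :=
  gencf [seq (b i, x + (-1) ^+ i) | i <- iota j n].

Lemma alt_cf0 (F : fieldType) (x : F) b j : alt_cf x b j 0 = 0.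
Proof. by []. Qed.

Lemma alt_cfS (F : fieldType) (x : F) b j n :
  alt_cf x b j n.+1 = b j / (x + (-1) ^+ j + alt_cf x b j.+1 n).
Proof. by []. Qed.

(* Each denominator of the level l fraction in x^2 is a product of two
   consecutive denominators of the level l+1 fraction in x; the case
   [b0 = t0 = 0] covers the start of the fraction. *)
Lemma alternating_dens_mul (R : comNzRingType) (x b0 b1 e t0 t1 t2 : R) :
    t0 * (x + 1 + t1) = b0 -> t1 * (x - 1 + t2) = b1 -> b0 + b1 = 1 + e ->
  (x - 1 + t0) * (x + 1 + t1) = x ^+ 2 + e - t1 * t2.
Proof.
move=> t0E t1E bE; have -> : e = b0 + b1 - 1 by rewrite bE; ring.
by rewrite -t0E -t1E; ring.
Qed.

Section Contraction.

Variables (F : fieldType) (x : F) (u w : nat -> F) (N : nat).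

Local Notation t := (alt_cf x w).
Local Notation s := (alt_cf (x ^+ 2) u).

Hypothesis den_neq0 : forall i n, x + (-1) ^+ i + t i.+1 n != 0.
Hypothesis w_mul_double :
  forall k, (k < N)%N -> w k.*2.+1 * w k.+1.*2 = - u k.+1.
Hypothesis w_add_double :
  forall k, (k < N)%N -> w k.+1.*2 + w k.+1.*2.+1 = 1 + (-1) ^+ k.+1.

Let even_den_neq0 k n : x + 1 + t k.*2.+1 n != 0.
Proof. by have := den_neq0 k.*2 n; rewrite -signr_odd odd_double. Qed.

Let odd_den_neq0 k n : x - 1 + t k.+1.*2 n != 0.
Proof. by have := den_neq0 k.*2.+1 n; rewrite -signr_odd /= odd_double. Qed.

Lemma alt_cf_double k n : t k.*2 n.+1 * (x + 1 + t k.*2.+1 n) = w k.*2.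
Proof. by rewrite alt_cfS -signr_odd odd_double mulfVK. Qed.

Lemma alt_cf_doubleS k n :
  t k.*2.+1 n.+1 * (x - 1 + t k.+1.*2 n) = w k.*2.+1.
Proof.
by rewrite alt_cfS -signr_odd /= odd_double mulfVK //; apply: odd_den_neq0.
Qed.

Lemma alt_cf_contraction k n : (k + n <= N)%N ->
  s k.+1 n = - (t k.*2.+1 n.*2.+1 * t k.+1.*2 n.*2).
Proof.
elim: n k => [|n IHn] k kn; first by rewrite !alt_cf0 mulr0 oppr0.
have kN : (k < N)%N by lia.
have t0E := alt_cf_double k.+1 n.*2.+1.
have t1E := alt_cf_doubleS k.+1 n.*2.
have dens_mul := alternating_dens_mul t0E t1E (w_add_double kN).
rewrite alt_cfS IHn ?addSnnS // -dens_mul.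
rewrite -[u _]opprK -w_mul_double // -(alt_cf_doubleS k n.*2.+2) -[w _]t0E.
by rewrite mulrACA mulNr mulfK // mulf_neq0 ?even_den_neq0 ?odd_den_neq0.
Qed.

Lemma alt_cf_sqr n : (n <= N)%N -> w 0 = u 0 -> w 1 = 2 ->
  t 0 n.+1.*2 = (x - 1) * s 0 n.+1.
Proof.
move=> nN w0 w1; rewrite doubleS !alt_cfS alt_cf_contraction //.
have x_neq1 : x - 1 != 0 by have := den_neq0 1 0; rewrite addr0.
have t1E : t 1 n.*2.+1 * (x - 1 + t 2 n.*2) = 2.
  by rewrite -w1; apply: alt_cf_doubleS 0 _.
rewrite -(alternating_dens_mul (mul0r _) t1E) ?add0r // addr0 invfM w0.
by rewrite [RHS]mulrCA mulVKf.
Qed.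

End Contraction.

Lemma fraction_numden (R : idomainType) (x : {fraction R}) :
  x = (\n_(repr x))%:F / (\d_(repr x))%:F.
Proof.
rewrite -{1}[x]reprK; case: (repr x) => -[n d] /= d0; rewrite !piE.
apply/eqmodP; rewrite /= FracField.equivfE /FracField.mulf /FracField.invf.
by rewrite !numden_Ratio ?mulr1 ?mul1r ?oner_eq0 // mulrC.
Qed.

Lemma ltn_size_mul2r (R : idomainType) (p q r : {poly R}) : r != 0 ->
  (size (p * r)%R < size (q * r)%R)%N = (size p < size q)%N.
Proof.
move=> r0; have [->|q0] := eqVneq q 0; first by rewrite mul0r size_poly0 !ltn0.
have [->|p0] := eqVneq p 0.
  by rewrite mul0r size_poly0 !size_poly_gt0 mulf_neq0.
rewrite -ltnS !size_mul // !prednK ?addn_gt0 ?size_poly_gt0 ?p0 ?q0 //.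
exact: ltn_add2r.
Qed.

(* [Qz_const] is the case [R := rat], up to conversion. *)
Definition fracpolyC {R : idomainType} : R -> {fraction {poly R}} :=
  @tofrac _ \o polyC.

HB.instance Definition _ (R : idomainType) :=
  GRing.RMorphism.on (@fracpolyC R).

Section ProperFraction.

Variable R : idomainType.
Implicit Types (p q n d : {poly R}) (x y : {fraction {poly R}}).
Implicit Types (a : seq {poly R}) (s : seq (R * {poly R})).

Definition proper_fraction : {pred {fraction {poly R}}} :=
  fun x => (size \n_(repr x) < size \d_(repr x))%N.

Lemma proper_fracE n d :
  d != 0 -> (n%:F / d%:F \in proper_fraction) = (size n < size d)%N.
Proof.
move=> d0; rewrite unfold_in; set x := n%:F / d%:F.
have dx0 : \d_(repr x) != 0 := denom_ratioP _.
have /eqP := fraction_numden x.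
rewrite eqr_div ?tofrac_eq0 // -!tofracM tofrac_eq => /eqP cross.
by rewrite -(ltn_size_mul2r _ _ d0) -cross [\d_ _ * d]mulrC ltn_size_mul2r.
Qed.

Lemma proper_fractionP x :
  reflect (exists n d, (size n < size d)%N /\ x = n%:F / d%:F)
    (x \in proper_fraction).
Proof.
apply: (iffP idP) => [prop_x|[n [d [lt_nd ->]]]].
  by exists \n_(repr x), \d_(repr x); split=> //; apply: fraction_numden.
by rewrite proper_fracE // -size_poly_gt0; lia.
Qed.

Lemma proper_tofrac p : (p%:F \in proper_fraction) = (p == 0).
Proof.
rewrite -[p%:F]divr1 -tofrac1 proper_fracE ?oner_eq0 //.
by rewrite size_poly1 ltnS leqn0 size_poly_eq0.
Qed.

Lemma proper_fraction_zmod_closed : zmod_closed proper_fraction.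
Proof.
split=> [|x y]; first by rewrite -tofrac0 proper_tofrac.
move=> /proper_fractionP[n [d [nd ->]]] /proper_fractionP[n' [d' [nd' ->]]].
have d0 : d != 0 by rewrite -size_poly_gt0; lia.
have d'0 : d' != 0 by rewrite -size_poly_gt0; lia.
rewrite -mulNr -tofracN addf_div ?tofrac_eq0 // -!tofracM -tofracD.
rewrite proper_fracE ?mulf_neq0 //.
apply: leq_ltn_trans (size_polyD _ _) _; rewrite gtn_max mulNr size_polyN.
by rewrite ltn_size_mul2r // nd [d * d']mulrC ltn_size_mul2r.
Qed.

HB.instance Definition _ := GRing.isZmodClosed.Build {fraction {poly R}}
  proper_fraction proper_fraction_zmod_closed.

Lemma tofracD_proper_inj p q x y :
    x \in proper_fraction -> y \in proper_fraction ->
  p%:F + x = q%:F + y -> p = q.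
Proof.
move=> prop_x prop_y eq_pq; apply/eqP.
rewrite -subr_eq0 -proper_tofrac tofracB.
have -> : p%:F - q%:F = y - x.
  by apply/eqP; rewrite subr_eq addrAC -subr_eq opprK eq_pq addrC.
exact: rpredB.
Qed.

Lemma tofracD_proper_neq0 p x :
  p != 0 -> x \in proper_fraction -> p%:F + x != 0.
Proof.
move=> p0 prop_x; apply: contraNneq p0 => px0; apply/eqP.
by apply: tofracD_proper_inj prop_x (rpred0 _) _; rewrite px0 tofrac0 addr0.
Qed.

Definition nonconstant p : bool := (1 < size p)%N.

Lemma nonconstant_neq0 p : nonconstant p -> p != 0.
Proof. by rewrite -size_poly_gt0; apply: ltnW. Qed.

Lemma proper_fraction_div c p x : nonconstant p -> x \in proper_fraction ->
  fracpolyC c / (p%:F + x) \in proper_fraction.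
Proof.
move=> p1 /proper_fractionP[n [d [nd ->]]].
have d0 : d != 0 by rewrite -size_poly_gt0; lia.
have size_pd : (size d < size (p * d)%R)%N.
  by rewrite -{1}[d]mul1r ltn_size_mul2r // size_poly1.
have size_den : size (p * d + n) = size (p * d).
  by rewrite size_polyDl // (ltn_trans nd).
have -> : fracpolyC c / (p%:F + n%:F / d%:F) = (c%:P * d)%:F / (p * d + n)%:F.
  rewrite tofracD !tofracM -{1}[p%:F](mulfK (_ : d%:F != 0)) ?tofrac_eq0 //.
  by rewrite -mulrDl invf_div mulrA.
rewrite proper_fracE -?size_poly_gt0 size_den ?(leq_ltn_trans _ size_pd) //.
by rewrite mul_polyC size_scale_leq.
Qed.

Definition poly_gencf s : {fraction {poly R}} :=
  gencf [seq (fracpolyC bc.1, bc.2%:F) | bc <- s].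

Definition regcf a : {fraction {poly R}} :=
  gencf [seq (1, tofrac p) | p : {poly R} <- a].

Lemma poly_gencf_proper s :
  all (nonconstant \o snd) s -> poly_gencf s \in proper_fraction.
Proof.
elim: s => [_|[b p] s IHs /= /andP[p1 /IHs]]; first exact: rpred0.
exact: proper_fraction_div.
Qed.

Lemma regcf_cons p a : regcf (p :: a) = (p%:F + regcf a)^-1.
Proof. exact: mul1r. Qed.

Lemma regcfE a : regcf a = poly_gencf [seq (1, p) | p <- a].
Proof.
elim: a => //= p a IHa.
by rewrite regcf_cons IHa -[LHS]mul1r -(rmorph1 fracpolyC).
Qed.

Lemma regcf_proper a : all nonconstant a -> regcf a \in proper_fraction.
Proof. by rewrite regcfE => a1; apply: poly_gencf_proper; rewrite all_map. Qed.

Lemma regcf_eq0 a : all nonconstant a -> (regcf a == 0) = nilp a.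
Proof.
case: a => [|p a /= /andP[p1 a1]]; first by rewrite eqxx.
rewrite regcf_cons invr_eq0; apply/negbTE/tofracD_proper_neq0.
  exact: nonconstant_neq0.
exact: regcf_proper.
Qed.

Lemma regcf_inj : {in all nonconstant &, injective regcf}.
Proof.
elim=> [|p a IHa] [|q b] // a1 b1.
- by move/esym/eqP; rewrite regcf_eq0.
- by move/eqP; rewrite regcf_eq0.
case/andP: a1 b1 => p1 a1 /andP[q1 b1]; rewrite !regcf_cons => /invr_inj eq_den.
have eq_pq : p = q by apply: tofracD_proper_inj eq_den; apply: regcf_proper.
by move: eq_den; rewrite eq_pq => /addrI/IHa->.
Qed.

End ProperFraction.

Lemma poly_gencf_regular (F : fieldType) (c : F) (s : seq (F * {poly F})) :
    c != 0 -> 0 \notin unzip1 s ->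
  exists2 a, [seq size p | p : {poly F} <- a] =
             [seq size p | p : {poly F} <- unzip2 s] &
    fracpolyC c * poly_gencf s = regcf a.
Proof.
elim: s c => [|[b p] s IHs] c c0 /=; first by exists [::]; rewrite ?mulr0.
rewrite inE negb_or eq_sym => /andP[b0 s0].
have cb0 : (c * b)^-1 != 0 by rewrite invr_eq0 mulf_neq0.
have [a size_a aE] := IHs _ cb0 s0.
exists ((c * b)^-1 *: p :: a); first by rewrite /= size_scale ?size_a.
rewrite regcf_cons -aE -mul_polyC tofracM -[_%:P%:F]/(fracpolyC _) -mulrDr.
by rewrite fmorphV invfM invrK rmorphM -mulrA.
Qed.

Lemma size_polyDsign (R : nzRingType) (p : {poly R}) i :
  (1 < size p)%N -> size (p + (-1) ^+ i) = size p.
Proof.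
by move=> p1; rewrite size_polyDl // -[_ ^+ i]mulr1 size_Msign size_poly1.
Qed.

Section AlternatingFraction.

Variables (F : fieldType) (p : {poly F}) (b : nat -> F).

Lemma alt_cf_poly_gencf j n : alt_cf p%:F (fracpolyC \o b) j n =
  poly_gencf [seq (b i, p + (-1) ^+ i) | i <- iota j n].
Proof.
rewrite /alt_cf /poly_gencf -map_comp; congr gencf; apply: eq_map => i /=.
by rewrite tofracD rmorph_sign.
Qed.

Lemma alt_cf_den_neq0 i j n : nonconstant p ->
  p%:F + (-1) ^+ i + alt_cf p%:F (fracpolyC \o b) j n != 0.
Proof.
move=> p1; have p_sign1 k : nonconstant (p + (-1) ^+ k).
  by rewrite /nonconstant size_polyDsign.
rewrite -(rmorph_sign (@tofrac _)) -tofracD.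
apply: tofracD_proper_neq0; first exact: nonconstant_neq0.
rewrite alt_cf_poly_gencf; apply: poly_gencf_proper; rewrite all_map.
by apply/allP=> k _; apply: p_sign1.
Qed.

End AlternatingFraction.

Definition g_at (F : fieldType) (x : F) (l : nat) : F :=
  x^-1 * \prod_(h < l.+1) (1 - x ^- (2 ^ h)).

Lemma g_at0 (F : fieldType) (x : F) : x != 0 -> x - 1 != 0 ->
  g_at x 0 = 1 / (x + 1 + 1 / (x - 1)).
Proof.
move=> x0 x1; rewrite /g_at big_ord1 expr1.
have -> : x + 1 + 1 / (x - 1) = x ^+ 2 / (x - 1) by field.
by field; rewrite x0 x1.
Qed.

Lemma g_atS (F : fieldType) (x : F) l : x != 0 ->
  g_at x l.+1 = (x - 1) * g_at (x ^+ 2) l.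
Proof.
move=> x0; rewrite /g_at big_ord_recl !mulrA; congr (_ * _); last first.
  by apply: eq_bigr => h _; rewrite lift0 expnS exprM.
by rewrite expr1; field.
Qed.

Lemma alt_cf_v_sqr l (p : {poly rat}) : nonconstant p ->
  alt_cf p%:F (fracpolyC \o v l.+1) 0 (2 ^ l.+2) =
    (p%:F - 1) * alt_cf (p%:F ^+ 2) (fracpolyC \o v l) 0 (2 ^ l.+1).
Proof.
move=> p1; have [n nE] : exists n, (2 ^ l.+1 = n.+1)%N.
  by exists (2 ^ l.+1).-1; rewrite prednK ?expn_gt0.
rewrite [(2 ^ l.+2)%N]expnS mul2n nE.
apply: (alt_cf_sqr (N := n)) => [i m|k kn|k _|||] //.
- exact: alt_cf_den_neq0.
- rewrite /comp -rmorphM -rmorphN v_double mulrN mulrCA divff ?mulr1 //.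
  by rewrite v_neq0 // [(2 ^ l.+2)%N]expnS; lia.
- by rewrite /comp -rmorphD v_doubleS addrC subrK rmorphD rmorph1 rmorph_sign.
- by case: (l).
- exact: rmorph_nat.
Qed.

Lemma g_at_alt_cf l (p : {poly rat}) : nonconstant p ->
  g_at p%:F l = alt_cf p%:F (fracpolyC \o v l) 0 (2 ^ l.+1).
Proof.
elim: l p => [|l IHl] p p1.
  have pB1 : p%:F - 1 != 0.
    by have := alt_cf_den_neq0 (fun=> 0) 1 0 0 p1; rewrite addr0.
  rewrite g_at0 ?tofrac_eq0 ?nonconstant_neq0 //.
  by rewrite !alt_cfS alt_cf0 /comp rmorph1 addr0.
rewrite g_atS ?tofrac_eq0 ?nonconstant_neq0 // alt_cf_v_sqr // -tofracXn IHl //.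
rewrite /nonconstant expr2 (ltn_trans p1) // -{1}[p]mul1r.
by rewrite ltn_size_mul2r ?size_poly1 ?nonconstant_neq0.
Qed.

Lemma g_alt_cf l : g l = alt_cf z (fracpolyC \o v l) 0 (2 ^ l.+1).
Proof. by apply: g_at_alt_cf; rewrite /nonconstant size_polyX. Qed.

Lemma g_linear_regcf l :
  exists2 a : seq {poly rat}, forall p, p \in a -> size p = 2%N & g l = regcf a.
Proof.
pose s : seq (rat * {poly rat}) :=
  [seq (v l i, 'X + (-1) ^+ i) | i <- iota 0 (2 ^ l.+1)].
have s_neq0 : 0 \notin unzip1 s.
  rewrite /unzip1 -map_comp; apply/mapP=> -[i]; rewrite mem_iota => /v_neq0.
  by move=> vi0 /esym/eqP; apply/negP.
have [a size_a aE] := poly_gencf_regular (oner_neq0 _) s_neq0.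
exists a; last by rewrite g_alt_cf -aE rmorph1 mul1r alt_cf_poly_gencf.
move=> p /(map_f (fun q : {poly rat} => size q)); rewrite size_a.
by rewrite -!map_comp => /mapP[i _ ->]; rewrite /= size_polyDsign size_polyX.
Qed.

Theorem theorem2p2 (l : nat) :
  [/\ (* the recursion defining v^(l) never divides by zero *)
      (forall j : nat, (1 <= j <= 2 ^ l - 1)%N -> v l (2 * j - 1) != 0),
      g l = gencf (mkseq (fun j => (Qz_const (v l j), den j)) (2 ^ l.+1)),
      (exists a : seq {poly rat}, cf_expansion (g l) 0 a)
    & (forall a : seq {poly rat}, cf_expansion (g l) 0 a ->
        forall p, p \in a -> size p = 2%N)].
Proof.
have [a a_linear gE] := g_linear_regcf l.
have a_nonconst : all (@nonconstant _) a.
  by apply/allP=> p /a_linear; rewrite /nonconstant => ->.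
split=> [j j_bound||| b [/allP b_nonconst]].
- by apply: v_neq0; rewrite expnS; lia.
- rewrite g_alt_cf; congr gencf; apply: eq_map => j; congr pair.
  by rewrite /den -signr_odd; case: odd.
- by exists a; split; [apply/allP | rewrite tofrac0 add0r].
by rewrite tofrac0 add0r gE => /(regcf_inj a_nonconst b_nonconst) <-.
Qed.
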